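(* There exists an absolute constant $C>0$ such that the following holds. Let $\varepsilon\in(0,1/4)$, let $t\geq 1$ be an integer, and let $n\geq 2^{t\cdot 2^{C(\log(1/\varepsilon))^8}}$. Let $G$ be a $2$-edge-coloured (red/blue) complete graph $K_n$ which is locally $(1/4+\varepsilon)$-balanced. Then $G$ contains two disjoint vertex sets $A,B$ with $|A|=|B|=t$ such that, for some colour $c\in\{\text{red},\text{blue}\}$, all edges inside $A$ and all edges inside $B$ have colour $c$ and all edges between $A$ and $B$ have the other colour. (Equivalently, $G$ contains a complete subgraph on $2t$ vertices in which one colour class forms exactly a $K_{t,t}$.)
   Context: A $2$-edge-coloured $K_n$ is called locally $\gamma$-balanced if every vertex is incident to at least $\gamma n$ red edges and at least $\gamma n$ blue edges. *)

(* Defs.v *)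
From mathcomp Require Import all_boot.
From Stdlib Require Import Reals.
Set Implicit Arguments. Unset Strict Implicit. Unset Printing Implicit Defensive.

(* A 2-edge-colouring of K_n on vertex set 'I_n: col u v = true means the
   edge uv is red, false means blue. Only values with u <> v matter. *)
Definition symmetric_colouring (n : nat) (col : 'I_n -> 'I_n -> bool) : Prop :=
  forall u v : 'I_n, col u v = col v u.

Definition coldeg (n : nat) (col : 'I_n -> 'I_n -> bool) (c : bool) (v : 'I_n) : nat :=
  #|[set u : 'I_n | (u != v) && (col v u == c)]|.

Definition locally_balanced (n : nat) (col : 'I_n -> 'I_n -> bool) (gamma : R) : Prop :=
  forall v : 'I_n,
    (gamma * INR n <= INR (coldeg col true v))%R /\
    (gamma * INR n <= INR (coldeg col false v))%R.

Definition has_split_pair (n : nat) (col : 'I_n -> 'I_n -> bool) (t : nat) : Prop :=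
  exists (A B : {set 'I_n}) (c : bool),
    [disjoint A & B] /\ #|A| = t /\ #|B| = t /\
    (forall x y, x \in A -> y \in A -> x != y -> col x y = c) /\
    (forall x y, x \in B -> y \in B -> x != y -> col x y = c) /\
    (forall x y, x \in A -> y \in B -> col x y = ~~ c).

(* Main.v *)
(* Call a colouring of a vertex set split if the vertices can be labelled by
   colours so that any two vertices with the same label c span an edge of colour c.
   A split set of m vertices has at most m^2/4 pairs (u, v) such that uv does not
   have the colour labelling u.  In a locally (1/4 + eps)-balanced colouring a
   second moment estimate shows that a random sample of O(eps^-2) vertices violates
   this bound, so it is not split.  By the Foldes-Hammer theorem such a sample
   contains at most five vertices that are not split, and averaging gives a positive
   proportion, polynomial in eps, of non-split 5-tuples with one colour pattern.
   An induction on the number of parts, alternating degree counting, pigeonhole on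
   neighbourhoods inside sets of logarithmic size, and Ramsey's theorem, blows this
   pattern up to five monochromatic cliques of size proportional to log n.  The
   colours of the cliques label the pattern; since it is not split, two cliques of
   the same colour are completely joined in the other colour. *)

Require Import Defs.
From mathcomp Require Import all_boot.
From mathcomp Require Import zify.
Set Implicit Arguments. Unset Strict Implicit. Unset Printing Implicit Defensive.

(** * Ramsey's theorem and blow-ups *)

Section Ramsey.
Variables (T : finType) (col : T -> T -> bool).
Hypothesis colC : forall u v, col u v = col v u.

Definition monochromatic (c : bool) (A : {set T}) : Prop :=
  forall x y, x \in A -> y \in A -> x != y -> col x y = c.

Lemma monochromatic_sub c (A B : {set T}) :
  B \subset A -> monochromatic c A -> monochromatic c B.
Proof. by move=> /subsetP sBA mA x y /sBA xA /sBA yA; apply: mA. Qed.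

Lemma monochromatic_setU1 c v (A : {set T}) :
  monochromatic c A -> (forall u, u \in A -> col v u = c) -> monochromatic c (v |: A).
Proof.
move=> mA vA x y /setU1P[->|xA] /setU1P[->|yA] nxy; first by rewrite eqxx in nxy.
- exact: vA.
- by rewrite colC; apply: vA.
- exact: mA.
Qed.

Lemma ramsey k l (X : {set T}) : 2 ^ (k + l) <= #|X| ->
  (exists2 A : {set T}, A \subset X & #|A| = k /\ monochromatic true A) \/
  (exists2 A : {set T}, A \subset X & #|A| = l /\ monochromatic false A).
Proof.
have mono0 c : monochromatic c set0 by move=> x y; rewrite inE.
have [N] := ubnP (k + l); elim: N k l X => // N IH [|k] [|l] X ltN leX;
  try by [left; exists set0; rewrite ?sub0set ?cards0
         | right; exists set0; rewrite ?sub0set ?cards0].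
have [v vX] : exists v, v \in X.
  by apply/set0Pn; rewrite -card_gt0; apply: leq_trans leX; rewrite expn_gt0.
pose Y c := [set u in X :\ v | col v u == c].
have sYX c : Y c \subset X by apply/subsetP=> u; rewrite !inE => /andP[/andP[]].
have vY c u : u \in Y c -> col v u = c by rewrite !inE => /andP[_ /eqP].
have nvY c : v \notin Y c by rewrite !inE eqxx.
have cardY : #|X| = (#|Y true| + #|Y false|).+1.
  rewrite (cardsD1 v) vX add1n; congr _.+1.
  rewrite -(cardsID [set u | col v u] (X :\ v)); congr (_ + _); apply: eq_card => u;
    by rewrite !inE; case: (col v u); rewrite ?andbT ?andbF.
have add c j (A : {set T}) : A \subset Y c -> #|A| = j /\ monochromatic c A ->
    exists2 B : {set T}, B \subset X & #|B| = j.+1 /\ monochromatic c B.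
  move=> sAY [cA mA]; exists (v |: A).
    by apply/subsetP=> u /setU1P[->//|/(subsetP sAY)/(subsetP (sYX c))].
  split; first by rewrite cardsU1 cA (contra (subsetP sAY v)) ?nvY.
  by apply: monochromatic_setU1 => // u /(subsetP sAY)/vY.
have [leYt|ltYt] := leqP (2 ^ (k + l.+1)) #|Y true|.
  case: (IH k l.+1 (Y true) ltN leYt) => // [[A sA]|[A sA HA]].
    by move/(add _ _ _ sA); left.
  by right; exists A => //; apply: subset_trans (sYX true).
have leYf : 2 ^ (k.+1 + l) <= #|Y false|.
  by move: leX ltYt; rewrite cardY addSn expnS -addSnnS; lia.
have ltN' : k.+1 + l < N by rewrite addSnnS.
case: (IH k.+1 l (Y false) ltN' leYf) => // [[A sA HA]|[A sA]].
  by left; exists A => //; apply: subset_trans (sYX false).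
by move/(add _ _ _ sA); right.
Qed.

Lemma ramsey_diag k (X : {set T}) : 2 ^ (2 * k) <= #|X| ->
  exists A : {set T}, [/\ A \subset X, #|A| = k & exists c, monochromatic c A].
Proof.
rewrite mul2n -addnn => /ramsey[[A sA [cA mA]]|[A sA [cA mA]]].
  by exists A; split=> //; exists true.
by exists A; split=> //; exists false.
Qed.

End Ramsey.

(** * Weighted sums over products of sets *)

Section Transversals.
Variable T : finType.
Implicit Types (w : seq T -> nat) (As Bs : seq {set T}).

Fixpoint transversal_sum w As : nat :=
  if As is A :: As' then \sum_(a in A) transversal_sum (fun s => w (a :: s)) As'
  else w [::].

Definition prod_card As := \prod_(A <- As) #|A|.

Lemma transversal_sum_le w1 w2 As :
  (forall s, size s = size As -> w1 s <= w2 s) ->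
  transversal_sum w1 As <= transversal_sum w2 As.
Proof.
elim: As w1 w2 => [|A As IH] w1 w2 le12 /=; first exact: le12.
by apply: leq_sum => a _; apply: IH => s szs; apply: le12; rewrite /= szs.
Qed.

Lemma transversal_sumM c w As :
  transversal_sum (fun s => c * w s) As = c * transversal_sum w As.
Proof. by elim: As w => //= A As IH w; rewrite big_distrr; apply: eq_bigr. Qed.

Lemma transversal_sumD w1 w2 As :
  transversal_sum (fun s => w1 s + w2 s) As = transversal_sum w1 As + transversal_sum w2 As.
Proof. by elim: As w1 w2 => //= A As IH w1 w2; rewrite -big_split; apply: eq_bigr. Qed.

Lemma transversal_sum_const c As : transversal_sum (fun=> c) As = c * prod_card As.
Proof.
rewrite /prod_card; elim: As => [|A As IH] /=; first by rewrite big_nil muln1.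
by rewrite big_cons sum_nat_const IH mulnCA.
Qed.

Lemma exchange_transversal_sum (X : {set T}) (w : T -> seq T -> nat) As :
  \sum_(v in X) transversal_sum (w v) As = transversal_sum (fun s => \sum_(v in X) w v s) As.
Proof.
elim: As w => //= A As IH w; rewrite exchange_big /=.
by apply: eq_bigr => a _; apply: IH.
Qed.

Lemma transversal_sum_gt0 w As :
  0 < transversal_sum w As -> exists2 s, size s = size As & 0 < w s.
Proof.
elim: As w => [|A As IH] w /=; first by exists [::].
rewrite lt0n sum_nat_eq0 negb_forall => /existsP[a]; rewrite negb_imply -lt0n.
by case/andP=> _ /IH[s szs ws]; exists (a :: s); rewrite /= ?szs.
Qed.

Fixpoint subsets Bs As : bool :=
  match Bs, As with
  | B :: Bs', A :: As' => (B \subset A) && subsets Bs' As'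
  | [::], [::] => true
  | _, _ => false
  end.

Lemma prod_card_subsets Bs As : subsets Bs As -> prod_card Bs <= prod_card As.
Proof.
rewrite /prod_card; elim: Bs As => [|B Bs IH] [|A As] //= /andP[sBA sub].
by rewrite !big_cons leq_mul ?subset_leq_card ?IH.
Qed.

(** The ratio of the two products is a product of ratios at most 1, so no single factor shrinks by
    more than the whole product does. *)
Lemma subsets_card_ge c Bs As : subsets Bs As -> 0 < prod_card As ->
  prod_card As <= c * prod_card Bs ->
  forall B, B \in Bs -> exists A, [/\ A \in As, B \subset A & #|A| <= c * #|B|].
Proof.
rewrite /prod_card; elim: Bs As c => [|B Bs IH] [|A As] c //= /andP[sBA sub].
rewrite !big_cons muln_gt0 => /andP[A0 As0] le B'.
rewrite inE => /predU1P[->|B'Bs].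
  exists A; split; rewrite ?inE ?eqxx //.
  rewrite -(leq_pmul2r As0); apply: leq_trans le _.
  by rewrite mulnA leq_mul2l (prod_card_subsets sub) orbT.
have [|A' [A'As sB' leA']] := IH As c sub As0 _ B' B'Bs.
  rewrite -(leq_pmul2l A0); apply: leq_trans le _.
  by rewrite mulnCA leq_mul2r subset_leq_card ?orbT.
by exists A'; split; rewrite ?inE ?A'As ?orbT.
Qed.

End Transversals.

(** * Patterns of tuples and their blow-ups *)

Section Blowup.
Variables (T : finType) (E : eqType) (e : T -> T -> E).
Implicit Types (row : seq E) (As Bs : seq {set T}).

(* Row i of [pattern s] lists the colours from the i-th entry of s to the later ones. *)
Fixpoint pattern (s : seq T) : seq (seq E) :=
  if s is v :: s' then map (e v) s' :: pattern s' else [::].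

Lemma size_pattern s : size (pattern s) = size s.
Proof. by elim: s => //= v s ->. Qed.

Lemma pattern_ext v0 s1 s2 : size s1 = size s2 ->
  (forall i j, i < size s1 -> j < size s1 ->
    e (nth v0 s1 i) (nth v0 s1 j) = e (nth v0 s2 i) (nth v0 s2 j)) ->
  pattern s1 = pattern s2.
Proof.
elim: s1 s2 => [|v1 s1 IH] [|v2 s2] //= [szs] H; congr (_ :: _); last first.
  by apply: IH => // i j lti ltj; apply: (H i.+1 j.+1).
apply: (@eq_from_nth _ (e v0 v0)); rewrite !size_map // => i lti.
by rewrite !(nth_map v0) -?szs //; apply: (H 0 i.+1).
Qed.

Fixpoint joined (v : T) row As : Prop :=
  match row, As with
  | r :: row', A :: As' => (forall b, b \in A -> e v b = r) /\ joined v row' As'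
  | [::], [::] => True
  | _, _ => False
  end.

Fixpoint blowup (p : seq (seq E)) As : Prop :=
  match p, As with
  | row :: p', A :: As' => (forall a, a \in A -> joined a row As') /\ blowup p' As'
  | [::], [::] => True
  | _, _ => False
  end.

Fixpoint neighbours (v : T) row As : seq {set T} :=
  match row, As with
  | r :: row', A :: As' => [set b in A | e v b == r] :: neighbours v row' As'
  | _, _ => [::]
  end.

Lemma joined_subsets v row Bs As : subsets Bs As -> joined v row As -> joined v row Bs.
Proof.
elim: row Bs As => [|r row IH] [|B Bs] [|A As] //= /andP[/subsetP sBA sub] [vA vAs].
by split; [move=> b /sBA/vA | apply: IH vAs].
Qed.

Lemma blowup_subsets p Bs As : subsets Bs As -> blowup p As -> blowup p Bs.
Proof.
elim: p Bs As => [|row p IH] [|B Bs] [|A As] //= /andP[/subsetP sBA sub] [vA vAs].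
by split; [move=> b /sBA/vA; apply: joined_subsets | apply: IH vAs].
Qed.

Lemma size_blowup p As : blowup p As -> size As = size p.
Proof. by elim: p As => [|row p IH] [|A As] //= [_ /IH ->]. Qed.

Lemma neighbours_subsets v row As : size row = size As -> subsets (neighbours v row As) As.
Proof.
elim: row As => [|r row IH] [|A As] //= [/IH ->]; rewrite andbT.
by apply/subsetP=> b; rewrite inE => /andP[].
Qed.

Lemma neighbours_joined v row As : size row = size As -> joined v row (neighbours v row As).
Proof.
elim: row As => [|r row IH] [|A As] //= [/IH ?]; split=> // b.
by rewrite inE => /andP[_ /eqP].
Qed.

(** A tuple of positive weight has each entry in the corresponding neighbourhood of [v], so passing
    to neighbourhoods discards only zero terms. *)
Lemma transversal_sum_neighbours (w : seq T -> nat) v row As :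
  (forall s, size s = size As -> 0 < w s -> map (e v) s = row) ->
  transversal_sum w As <= transversal_sum w (neighbours v row As).
Proof.
elim: As w row => [|A As IH] w [|r row] //= wrow.
  rewrite leqNgt; apply/negP => lt.
  have /(@transversal_sum_gt0 _ _ (A :: As))[[|a s] // szs ws] := leq_ltn_trans (leq0n _) lt.
  by have := wrow _ szs ws.
rewrite [X in X <= _](bigID (fun a => e v a == r)) /= [X in _ + X]big1 ?addn0 => [|a /andP[aA ner]].
  rewrite [X in _ <= X](eq_bigl (fun a => (a \in A) && (e v a == r))) => [|a]; last by rewrite inE.
  apply: leq_sum => a /andP[aA /eqP ear]; apply: IH => s szs ws.
  by have [] := wrow (a :: s) (congr1 S szs) ws.
apply/eqP; rewrite -leqn0 leqNgt; apply/negP => /transversal_sum_gt0[s szs ws].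
by have [ear _] := wrow (a :: s) (congr1 S szs) ws; rewrite ear eqxx in ner.
Qed.

Lemma pigeonhole (S U : finType) (D : {set U}) (f : S -> U) (X : {set S}) (y0 : U) :
  y0 \in D -> {in X, forall v, f v \in D} ->
  exists2 y, y \in D & #|X| <= #|D| * #|[set v in X | f v == y]|.
Proof.
move=> y0D fD; pose fibre y := #|[set v in X | f v == y]|.
case: (@arg_maxnP _ y0 (mem D) fibre y0D) => y yD ymax.
exists y => //; rewrite -sum1_card (partition_big f (mem D)) //= -sum_nat_const.
apply: leq_sum => z zD; apply: leq_trans (ymax _ zD).
by rewrite /fibre -sum1_card; apply: eq_leq; apply: eq_bigl => v; rewrite inE.
Qed.

(** A set of at most [M] elements has at most [2 ^ M] subsets, so at most [2 ^ (size As * M)] lists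
    of neighbourhoods compete. For sets of logarithmic size this loss is affordable. *)
Lemma pigeonhole_neighbours M row As (X : {set T}) :
  size row = size As -> (forall A, A \in As -> #|A| <= M) ->
  exists Bs (Y : {set T}), [/\ Y \subset X, #|X| <= 2 ^ (size As * M) * #|Y|
    & forall v, v \in Y -> neighbours v row As = Bs].
Proof.
elim: row As => [|r row IH] [|A As] //= => [_ _|[/IH{}IH] leM].
  by exists [::], X; split; rewrite ?mul1n.
have [|Bs [Y [sYX leX YBs]]] := IH; first by move=> B BAs; apply: leM; rewrite inE BAs orbT.
pose f v := [set b in A | e v b == r].
have [||B _ leY] := @pigeonhole _ _ (powerset A) f Y set0.
- by rewrite inE sub0set.
- by move=> v _; rewrite inE; apply/subsetP=> b; rewrite inE => /andP[].
exists (B :: Bs), [set v in Y | f v == B]; split.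
- by apply/subsetP=> v; rewrite inE => /andP[/(subsetP sYX)].
- apply: leq_trans leX _; rewrite mulSn addnC expnD -mulnA leq_mul2l; apply/orP; right.
  apply: leq_trans leY _; rewrite card_powerset leq_mul2r leq_exp2l ?leM ?orbT //.
  by rewrite inE eqxx.
by move=> v; rewrite inE => /andP[/YBs -> /eqP <-].
Qed.

End Blowup.

(* [1 / dens k q] is the proportion of transversals that survive when a set of
   k-tuples of density [1 / q] is blown up to k parts, and [loss k q] the factor by
   which the parts may shrink: passing to the (k-1)-tuples with many extensions
   halves the density, and keeping the popular last vertices costs the rest. *)
Fixpoint dens (k q : nat) : nat := if k is k'.+1 then 4 * q * dens k' (2 * q) else 1.
Fixpoint loss (k q : nat) : nat := if k is k'.+1 then dens k q * loss k' (2 * q) else 1.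

Lemma dens_gt0 k q : 0 < q -> 0 < dens k q.
Proof. by elim: k q => //= k IH q q0; rewrite !muln_gt0 q0 IH // muln_gt0 q0. Qed.

Lemma loss_gt0 k q : 0 < q -> 0 < loss k q.
Proof.
elim: k q => // k IH q q0.
change (0 < dens k.+1 q * loss k (2 * q)).
by rewrite muln_gt0 dens_gt0 // IH // muln_gt0.
Qed.

(** A reverse Markov inequality: the unpopular vertices contribute at most [a / (2 * c)] each, half
    of the guaranteed sum in total, and a popular one contributes at most [a]. *)
Lemma popular (T : finType) (X : {set T}) (f : T -> nat) (a c : nat) :
  0 < a -> (forall v, v \in X -> f v <= a) -> #|X| * a <= c * \sum_(v in X) f v ->
  #|X| <= 2 * c * #|[set v in X | a <= 2 * c * f v]|.
Proof.
move=> a0 fa le; set Y := [set v in X | _].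
have sYX : Y \subset X by apply/subsetP=> v; rewrite inE => /andP[].
suff : 2 * c * \sum_(v in X) f v <= 2 * c * (#|Y| * a) + #|X| * a.
  by move=> le2; rewrite -(leq_pmul2r a0) -!mulnA; lia.
rewrite (big_setID Y) /= (setIidPr sYX) mulnDr leq_add //.
  rewrite leq_mul2l; apply/orP; right; rewrite -sum_nat_const.
  by apply: leq_sum => v /(subsetP sYX)/fa.
rewrite big_distrr /=; apply: (@leq_trans (\sum_(v in X :\: Y) a)).
  by apply: leq_sum => v; rewrite !inE => /andP[nY vX]; rewrite vX -ltnNge in nY; apply: ltnW.
by rewrite sum_nat_const leq_mul2r subset_leq_card ?orbT // subsetDl.
Qed.

(** * Blowing up a pattern of positive density *)

Section BlowupExists.
Variables (T : finType) (E : eqType) (e : T -> T -> E) (col : T -> T -> bool).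
Hypothesis colC : forall u v, col u v = col v u.

(* Besides the blow-up, the induction keeps a positive proportion of the transversals
   in S: this makes many single vertices joined to large parts of all sets A at once. *)
Theorem blowup_exists (M : nat) (p : seq (seq E)) (q : nat) (S : pred (seq T)) :
  0 < M -> 0 < q -> (forall s, size s = size p -> S s -> pattern e s = p) ->
  #|T| ^ size p <= q * transversal_sum S (nseq (size p) setT) ->
  dens (size p) q * 2 ^ ((size p).+1 * M) <= #|T| ->
  exists As : seq {set T}, [/\ blowup e p As,
    (forall A, A \in As -> #|A| <= M /\ M <= loss (size p) q * #|A|),
    (forall A, A \in As -> exists c, monochromatic col c A)
    & prod_card As <= dens (size p) q * transversal_sum S As].
Proof.
move=> M0; elim: p q S => [|row p IH] q S q0 Sp leS leT.
  exists [::]; split=> //=; rewrite /prod_card big_nil.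
  by move: leS => /=; case: (S [::]) => //=; rewrite muln0.
set k := size p in IH Sp leS leT *; set n := #|T| in leS leT *.
rewrite -[size (row :: p)]/k.+1 in Sp leS leT *.
have q20 : 0 < 2 * q by rewrite muln_gt0.
have dk0 := @dens_gt0 k _ q20.
have densS : dens k.+1 q = 4 * q * dens k (2 * q) by [].
have lossS : loss k.+1 q = dens k.+1 q * loss k (2 * q) by [].
have n0 : 0 < n by apply: leq_trans leT; rewrite muln_gt0 dens_gt0 ?expn_gt0.
(* Tuples lose their first entry: [ext s] counts the vertices that complete [s], and [S'] keeps the
   tails with at least [n / (2 * q)] of them. *)
pose ext (s : seq T) := \sum_(v in [set: T]) (S (v :: s) : nat).
have extn s : ext s <= n.
  apply: (@leq_trans (\sum_(v in [set: T]) 1)); first by apply: leq_sum => v _; case: (S _).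
  by rewrite sum1_card cardsT.
pose S' : pred (seq T) := fun s => n <= 2 * q * ext s.
have prodT j : prod_card (nseq j [set: T]) = n ^ j.
  by rewrite /prod_card; elim: j => [|j IHj]; rewrite ?big_nil //= big_cons IHj cardsT expnS.
have S'p s : size s = k -> S' s -> pattern e s = p.
  move=> szs S's; have : 0 < ext s by move: S's; rewrite /S'; case: (ext s); lia.
  rewrite lt0n sum_nat_eq0 negb_forall => /existsP[v]; rewrite negb_imply => /andP[_].
  by rewrite eqb0 negbK => /(Sp (v :: s) (congr1 succn szs)) [].
(* Tails outside [S'] account for at most [n ^ k * n / (2 * q)] tuples, half of what [S] guarantees;
   a tail in [S'] accounts for at most [n]. *)
have leS' : n ^ k <= 2 * q * transversal_sum S' (nseq k setT).
  have : transversal_sum S (nseq k.+1 setT) = transversal_sum ext (nseq k setT).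
    by rewrite /= exchange_transversal_sum.
  move=> eqS; rewrite eqS in leS.
  have : 2 * q * transversal_sum ext (nseq k setT) <=
         2 * q * n * transversal_sum S' (nseq k setT) + n * n ^ k.
    rewrite -!transversal_sumM -prodT -transversal_sum_const -transversal_sumD.
    apply: transversal_sum_le => s _; rewrite /S'.
    case: (leqP n) => [_|/ltnW] /=; last by rewrite muln0.
    by rewrite muln1 (leq_trans _ (leq_addr _ _)) // leq_mul2l extn orbT.
  rewrite expnS in leS => le; rewrite -(leq_pmul2l n0); lia.
have leT' : dens k (2 * q) * 2 ^ (k.+1 * M) <= n.
  apply: leq_trans leT; rewrite densS leq_mul ?leq_pmull ?muln_gt0 //.
  by rewrite leq_exp2l // leq_mul2r leqnSn orbT.
have [As [blA cardA monoA prodA]] := IH _ _ q20 S'p leS' leT'.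
have szA := size_blowup blA.
have prodA0 : 0 < prod_card As.
  rewrite /prod_card big_seq; apply: prodn_cond_gt0 => A /cardA[_ leM].
  by move: (leq_trans M0 leM); rewrite muln_gt0 => /andP[].
pose link v := transversal_sum (fun s => S (v :: s)) As.
pose P := 2 * q * dens k (2 * q).
have densE : dens k.+1 q = 2 * P by rewrite densS /P; lia.
have link_le v : v \in [set: T] -> link v <= prod_card As.
  move=> _; rewrite -[X in _ <= X]mul1n -transversal_sum_const.
  by apply: transversal_sum_le => s _; case: (S _).
(* By induction at least [1 / dens k (2 * q)] of the transversals of [As] lie in [S'], and each has
   at least [n / (2 * q)] completions; double counting bounds the average of [link]. *)
have sum_link : #|[set: T]| * prod_card As <= P * \sum_(v in [set: T]) link v.
  rewrite exchange_transversal_sum -/ext cardsT -/n.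
  apply: (@leq_trans (dens k (2 * q) * (n * transversal_sum S' As))).
    by rewrite mulnCA leq_mul2l prodA orbT.
  rewrite /P [2 * q * _]mulnC -mulnA leq_mul2l; apply/orP; right.
  rewrite -!transversal_sumM; apply: transversal_sum_le => s _; rewrite /S'.
  by case: (leqP n) => /=; rewrite ?muln0 ?muln1.
have := popular prodA0 link_le sum_link; rewrite cardsT -/n -densE.
set X := [set v in _ | _] => leX.
have Xlink v : v \in X -> prod_card As <= dens k.+1 q * link v by rewrite inE => /andP[].
have link_gt0 v : v \in X -> 0 < link v.
  by move/Xlink; move: prodA0; case: (link v); lia.
have linkrow v s : size s = size As -> 0 < (S (v :: s) : nat) -> map (e v) s = row.
  by rewrite szA => szs; rewrite lt0b => /(Sp (v :: s) (congr1 succn szs)) [].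
(* Nothing in the type of [p] ties the length of a row to its position; the length is read off an
   actual member of [S]. *)
have szrow : size row = size As.
  have [v vX] : exists v, v \in X.
    by apply/set0Pn; rewrite -card_gt0; move: leX; case: #|X|; lia.
  have [s szs /linkrow <-//] := transversal_sum_gt0 (link_gt0 v vX).
  by rewrite size_map.
have cardAM A : A \in As -> #|A| <= M by case/cardA.
have [Bs [Y [sYX leY YBs]]] := pigeonhole_neighbours e X szrow cardAM.
(* Of the exponent [k.+2 * M] in the hypothesis, [k * M] pays for the common neighbourhoods and
   [2 * M] for Ramsey's theorem inside [Y]. *)
have Y_big : 2 ^ (2 * M) <= #|Y|.
  rewrite szA -/k in leY.
  have := leq_trans leT (leq_trans leX (leq_mul (leqnn _) leY)).
  rewrite leq_pmul2l ?dens_gt0 // -(addn2 k) mulnDl expnD.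
  by rewrite leq_pmul2l ?expn_gt0.
have [A [sAY cA monoA0]] := ramsey_diag colC Y_big.
have BsA v : v \in A -> Bs = neighbours e v row As by move/(subsetP sAY)/YBs.
have [v0 v0A] : exists v, v \in A by apply/set0Pn; rewrite -card_gt0 cA.
have subB : subsets Bs As by rewrite (BsA _ v0A); apply: neighbours_subsets.
(* All vertices of the new clique [A] have the neighbourhoods [Bs], so their many transversals
   survive in [Bs]. This keeps every part of [Bs] large and gives the density for [A :: Bs]. *)
have prodB v : v \in A -> prod_card As <= dens k.+1 q * transversal_sum (fun s => S (v :: s)) Bs.
  move=> vA; apply: (leq_trans (Xlink v _)).
    by rewrite (subsetP sYX) ?(subsetP sAY).
  by rewrite leq_mul2l (BsA _ vA) transversal_sum_neighbours ?orbT //; apply: linkrow.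
have sumB v : transversal_sum (fun s => S (v :: s)) Bs <= prod_card Bs.
  rewrite -[X in _ <= X]mul1n -transversal_sum_const.
  by apply: transversal_sum_le => s _; case: (S _).
have subcard := subsets_card_ge subB prodA0 (leq_trans (prodB _ v0A) (leq_mul (leqnn _) (sumB v0))).
exists (A :: Bs); split.
- split; last exact: blowup_subsets blA.
  by move=> v /BsA ->; apply: neighbours_joined.
- move=> B; rewrite inE => /predU1P[->|/subcard[B' [/cardA[leM geM] sBB' leB]]].
    by rewrite cA; split=> //; rewrite leq_pmull // loss_gt0.
  split; first exact: leq_trans (subset_leq_card sBB') leM.
  apply: leq_trans geM _; rewrite lossS [dens _ _ * _]mulnC -mulnA leq_mul2l.
  by rewrite leB orbT.
- move=> B; rewrite inE => /predU1P[->//|/subcard[B' [/monoA[c mB'] sBB' _]]].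
  by exists c; apply: monochromatic_sub mB'.
rewrite /prod_card big_cons -/(prod_card Bs) /= big_distrr /= -sum_nat_const.
apply: leq_sum => v vA; apply: leq_trans (prodB v vA).
exact: prod_card_subsets.
Qed.

End BlowupExists.

(** * The Foldes-Hammer theorem *)

Section FoldesHammer.
Variables (T : finType) (g : rel T).
Hypotheses (g_sym : symmetric g) (g_irr : irreflexive g).

(** Label [true] stands for the clique side and [false] for the independent side of a split graph;
    the test says that [f] fails as such a partition of [s]. *)
Definition conflict (f : T -> bool) (s : seq T) : bool :=
  has (fun u => has (fun v => [&& u != v, f u == f v & g u v == ~~ f u]) s) s.

(** Each of the two edges needs an endpoint labelled [true], and two such endpoints are not
    adjacent. *)
Lemma conflict_2K2 a b c d f : g a b -> g c d ->
  ~~ g a c -> ~~ g a d -> ~~ g b c -> ~~ g b d ->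
  uniq [:: a; b; c; d] /\ conflict f [:: a; b; c; d].
Proof.
move=> ab cd /negbTE ac /negbTE ad /negbTE bc /negbTE bd.
have nab : a != b by apply: contraTneq ab => ->; rewrite g_irr.
have ncd : c != d by apply: contraTneq cd => ->; rewrite g_irr.
have nac : a != c by apply: contraTneq cd => <-; rewrite ad.
have nad : a != d by apply: contraTneq cd => <-; rewrite g_sym ac.
have nbc : b != c by apply: contraTneq cd => <-; rewrite bd.
have nbd : b != d by apply: contraTneq cd => <-; rewrite g_sym bc.
split; first by rewrite /= !inE !negb_or nab nac nad nbc nbd ncd.
rewrite /conflict /= !eqxx nab ncd nac nad nbc nbd ab cd ac ad bc bd /=.
by case: (f a); case: (f b); case: (f c); case: (f d); rewrite /= ?orbT.
Qed.

(** Each diagonal, being a non-edge, needs an endpoint labelled [false], and two such endpoints are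
    adjacent. *)
Lemma conflict_C4 a b c d f : g a b -> g b c -> g c d -> g d a ->
  ~~ g a c -> ~~ g b d -> a != c -> b != d ->
  uniq [:: a; b; c; d] /\ conflict f [:: a; b; c; d].
Proof.
move=> ab bc cd; rewrite g_sym => ad /negbTE ac /negbTE bd nac nbd.
have nab : a != b by apply: contraTneq ab => ->; rewrite g_irr.
have nbc : b != c by apply: contraTneq bc => ->; rewrite g_irr.
have ncd : c != d by apply: contraTneq cd => ->; rewrite g_irr.
have nad : a != d by apply: contraTneq ad => ->; rewrite g_irr.
split; first by rewrite /= !inE !negb_or nab nac nad nbc nbd ncd.
rewrite /conflict /= !eqxx nab ncd nac nad nbc nbd ab cd ac ad bc bd /=.
by case: (f a); case: (f b); case: (f c); case: (f d); rewrite /= ?orbT.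
Qed.

(** Three of the five vertices share a label, and three vertices of a pentagon span both an edge and
    a non-edge. *)
Lemma conflict_C5 a b c d z f : g a b -> g b c -> g c d -> g d z -> g z a ->
  ~~ g a c -> ~~ g a d -> ~~ g b d -> ~~ g b z -> ~~ g c z ->
  uniq [:: a; b; c; d; z] /\ conflict f [:: a; b; c; d; z].
Proof.
move=> ab bc cd dz; rewrite g_sym => az /negbTE ac /negbTE ad /negbTE bd /negbTE bz /negbTE cz.
have nab : a != b by apply: contraTneq ab => ->; rewrite g_irr.
have nbc : b != c by apply: contraTneq bc => ->; rewrite g_irr.
have ncd : c != d by apply: contraTneq cd => ->; rewrite g_irr.
have ndz : d != z by apply: contraTneq dz => ->; rewrite g_irr.
have naz : a != z by apply: contraTneq az => ->; rewrite g_irr.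
have nac : a != c by apply: contraTneq cd => <-; rewrite ad.
have nad : a != d by apply: contraTneq cd => <-; rewrite g_sym ac.
have nbd : b != d by apply: contraTneq dz => <-; rewrite bz.
have nbz : b != z by apply: contraTneq dz => <-; rewrite g_sym bd.
have ncz : c != z by apply: contraTneq az => <-; rewrite ac.
split; first by rewrite /= !inE !negb_or nab nac nad naz nbc nbd nbz ncd ncz ndz.
rewrite /conflict /= !eqxx nab ncd nac nad nbc nbd naz nbz ncz ndz ab cd ac ad bc bd az bz cz dz /=.
by case: (f a); case: (f b); case: (f c); case: (f d); case: (f z); rewrite /= ?orbT.
Qed.

(** If no edge lies outside the chosen clique [K], membership in [K] is the labelling. Otherwise
    take an edge [x y] outside [K] and compare the non-neighbours of [x] and [y] in [K]:
    incomparable sets give a 4-cycle, nested ones are treated by [nested]. *)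
Theorem foldes_hammer (X : {set T}) :
  (exists f : T -> bool, forall u v, u \in X -> v \in X -> u != v -> f u = f v -> g u v = f u) \/
  (exists s : seq T, [/\ uniq s, size s <= 5, {subset s <= X} & forall f, conflict f s]).
Proof.
pose deg v := #|[set u in X | g v u]|.
pose w v := #|T|.+1 + deg v.
pose clique (K : {set T}) :=
  (K \subset X) && [forall u in K, forall v in K, (u != v) ==> g u v].
have cliqueP (K : {set T}) : K \subset X ->
    (forall u v, u \in K -> v \in K -> u != v -> g u v) -> clique K.
  move=> sKX HK; rewrite /clique sKX; apply/forall_inP => u uK; apply/forall_inP => v vK.
  by apply/implyP; apply: HK.
(* By the choice of w, K is a maximum clique of largest total degree. *)
have [|K clK Kmax] := @arg_maxnP _ (set0 : {set T}) clique (fun K : {set T} => \sum_(v in K) w v).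
  by apply: cliqueP => [|u v]; rewrite ?sub0set ?inE.
have /andP[/subsetP sKX /forall_inP gK'] := clK.
have gK u v : u \in K -> v \in K -> u != v -> g u v.
  by move=> uK vK nuv; have /forall_inP/(_ v vK)/implyP := gK' u uK; apply.
have cliqueU1 x (A : {set T}) : x \in X -> A \subset X ->
    (forall u v, u \in A -> v \in A -> u != v -> g u v) ->
    (forall v, v \in A -> g x v) ->
    forall u v, u \in x |: A -> v \in x |: A -> u != v -> g u v.
  move=> xX sAX gA gx u v /setU1P[->|uA] /setU1P[->|vA]; rewrite ?eqxx // => nuv.
  - exact: gx.
  - by rewrite g_sym gx.
  - exact: gA.
have subU1 x (A : {set T}) : x \in X -> A \subset X -> x |: A \subset X.
  by move=> xX sAX; apply/subsetP=> u /setU1P[->|/(subsetP sAX)].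
have sKuX u : K :\ u \subset X by apply/subsetP=> v; rewrite inE => /andP[_ /sKX].
have gKu u v1 v2 : v1 \in K :\ u -> v2 \in K :\ u -> v1 != v2 -> g v1 v2.
  by rewrite !inE => /andP[_ v1K] /andP[_ v2K]; apply: gK.
have nonnbr x : x \in X -> x \notin K -> exists2 u, u \in K & ~~ g x u.
  move=> xX xK; apply/exists_inP; apply: contraT; rewrite negb_exists_in => /forall_inP gx.
  have {}gx v : v \in K -> g x v by move/gx; rewrite negbK.
  have sK : K \subset X by apply/subsetP.
  have := Kmax _ (cliqueP _ (subU1 x K xX sK) (cliqueU1 x K xX sK gK gx)).
  by rewrite big_setU1 //= /w; lia.
have deg_le v : deg v <= #|T| by apply: max_card.
have found s : size s <= 5 -> {subset s <= X} -> (forall f, uniq s /\ conflict f s) ->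
    exists s, [/\ uniq s, size s <= 5, {subset s <= X} & forall f, conflict f s].
  move=> szs sX Hs; exists s; split=> // [|f]; last by case: (Hs f).
  by case: (Hs xpredT).
have nested x y : x \in X -> y \in X -> x \notin K -> y \notin K -> x != y -> g x y ->
    (forall u, u \in K -> ~~ g x u -> ~~ g y u) ->
    exists s, [/\ uniq s, size s <= 5, {subset s <= X} & forall f, conflict f s].
  move=> xX yX xK yK nxy gxy nest.
  have [u uK xu] := nonnbr x xX xK; have yu := nest u uK xu; have uX := sKX u uK.
  have [/exists_inP[u' u'K /andP[nuu' xu']]|] :=
      boolP [exists u' in K, (u' != u) && ~~ g x u'].
    apply: (found [:: u'; u; x; y]) => // [a|f].
      by rewrite !inE => /or4P[] /eqP-> //; apply: sKX.
    by apply: conflict_2K2 => //; first [exact: gK | rewrite g_sym ?nest].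
  rewrite negb_exists_in => /forall_inP Nx.
  have {}Nx v : v \in K :\ u -> g x v.
    by rewrite !inE => /andP[nvu vK]; have := Nx v vK; rewrite nvu negbK.
  have xKu : x \notin K :\ u by rewrite !inE negb_and xK orbT.
  have yKu : y \notin K :\ u by rewrite !inE negb_and yK orbT.
  have gU := cliqueU1 x _ xX (sKuX u) (gKu u) Nx.
  have sU := subU1 x _ xX (sKuX u).
  have [/exists_inP[v vK /andP[nvu yv]]|] :=
      boolP [exists v in K, (v != u) && ~~ g y v]; last first.
    rewrite negb_exists_in => /forall_inP Ny.
    have {}Ny v : v \in x |: (K :\ u) -> g y v.
      rewrite !inE => /predU1P[->|/andP[nvu vK]]; first by rewrite g_sym.
      by have := Ny v vK; rewrite nvu negbK.
    have := Kmax _ (cliqueP _ (subU1 y _ yX sU) (cliqueU1 y _ yX sU gU Ny)).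
    have yU : y \notin x |: (K :\ u) by rewrite !inE negb_or eq_sym nxy negb_and yK orbT.
    have sum_y : \sum_(v in y |: (x |: (K :\ u))) w v = w y + \sum_(v in x |: (K :\ u)) w v.
      exact: big_setU1.
    have sum_x : \sum_(v in x |: (K :\ u)) w v = w x + \sum_(v in K :\ u) w v.
      exact: big_setU1.
    have sum_K : \sum_(v in K) w v = w u + \sum_(v in K :\ u) w v by exact: big_setD1.
    (* Trading [u] for both [x] and [y] would raise the weight: two weights sum to at least
       [2 * #|T|.+1], one is at most [#|T|.+1 + #|T|]. *)
    rewrite /= leqNgt => /negP[]; rewrite sum_y sum_x sum_K addnA ltn_add2r /w.
    apply: (@leq_trans (#|T|.+1 + #|T|.+1)); last by rewrite leq_add ?leq_addr.
    by rewrite -addnS leq_add2l ltnS.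
  have gxv : g x v by apply: Nx; rewrite !inE nvu.
  have guv : g u v by apply: gK; rewrite // eq_sym.
  (* Trading [u] for [x] gives a clique, so [deg x <= deg u]. As [y] is adjacent to [x] and not to
     [u], some neighbour [z] of [u] is not adjacent to [x]. *)
  have := Kmax _ (cliqueP _ sU gU).
  rewrite big_setU1 //= (big_setD1 u uK) /= leq_add2r leq_add2l => deg_xu.
  have [z] : exists z, z \in [set a in X | g u a] :\: [set a in X | g x a].
    apply/set0Pn; apply: contraTneq deg_xu => /eqP; rewrite setD_eq0 => sub.
    rewrite -ltnNge; apply: proper_card; rewrite properEneq sub andbT.
    apply/eqP=> /setP/(_ y); rewrite !inE yX gxy g_sym.
    by rewrite (negbTE yu).
  rewrite !inE negb_and; case: (z \in X) / boolP => //= zX /andP[xz uz].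
  have zK : z \notin K.
    apply: contraNN xz => zK; apply: Nx; rewrite !inE zK andbT.
    by apply: contraTneq uz => ->; rewrite g_irr.
  have xv : x != v by apply: contraNneq xK => ->.
  have ux : ~~ g u x by rewrite g_sym.
  have uy : ~~ g u y by rewrite g_sym.
  have zx : ~~ g z x by rewrite g_sym.
  (* The edges [u z] and [x y] induce [2K2] unless [y z] is an edge; then [x y z v] is an induced
     4-cycle or [x y z u v] an induced pentagon, according to [z v]. *)
  have [yz|yz] := boolP (g y z); last first.
    apply: (found [:: u; z; x; y]) => // [a|f].
      by rewrite !inE => /or4P[] /eqP->.
    by apply: conflict_2K2 => //; rewrite g_sym.
  have vX := sKX v vK.
  have [zv|zv] := boolP (g z v).
    apply: (found [:: x; y; z; v]) => // [a|f].
      by rewrite !inE => /or4P[] /eqP->.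
    apply: conflict_C4 => //; first by rewrite g_sym.
      by apply: contraNneq ux => ->.
    by apply: contraNneq yK => ->.
  apply: (found [:: x; y; z; u; v]) => // [a|f].
    by rewrite !inE => /orP[/eqP->//|/or4P[] /eqP->].
  by apply: conflict_C5 => //; rewrite g_sym.
have [/exists_inP[x]|] :=
    boolP [exists x in X :\: K, [exists y in X :\: K, (x != y) && g x y]].
  rewrite !inE => /andP[xK xX] /exists_inP[y]; rewrite !inE => /andP[yK yX] /andP[nxy gxy]; right.
  (* With [u] missed only by [x] and [v] missed only by [y], the cycle [x v u y] has no chord; if
     [u] or [v] does not exist, the non-neighbourhoods are nested. *)
  have [/exists_inP[u uK /andP[xu yu]]|] := boolP [exists u in K, ~~ g x u && g y u]; last first.
    rewrite negb_exists_in => /forall_inP H; apply: (nested x y) => // u uK xu.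
    by have := H u uK; rewrite xu.
  have [/exists_inP[v vK /andP[yv xv]]|] := boolP [exists v in K, ~~ g y v && g x v]; last first.
    rewrite negb_exists_in => /forall_inP H; apply: (nested y x) => //;
      rewrite 1?eq_sym 1?g_sym // => v vK yv.
    by have := H v vK; rewrite yv.
  have nuv : u != v by apply: contraNneq xu => ->.
  apply: (found [:: x; v; u; y]) => // [a|f].
    by rewrite !inE => /or4P[] /eqP-> //; apply: sKX.
  apply: conflict_C4 => //.
  - by apply: gK; rewrite // eq_sym.
  - by rewrite g_sym.
  - by rewrite g_sym.
  - by rewrite g_sym.
  - by apply: contraNneq xK => ->.
  - by apply: contraNneq yK => <-.
rewrite negb_exists_in => /forall_inP indep; left; exists (mem K) => u v uX vX nuv /=.
case: (boolP (u \in K)) => uK vK; first by apply: gK.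
apply/negbTE; have /indep : u \in X :\: K by rewrite inE uK.
rewrite negb_exists_in => /forall_inP/(_ v); rewrite inE -vK vX nuv /=; exact.
Qed.

End FoldesHammer.

(** * Random samples are not split *)

From mathcomp Require all_order all_algebra ring lra.

Section SplitTuples.
Variables (T : finType) (e : T -> T -> option bool).

(* [e u v = None] stands for u = v: sampled tuples may repeat vertices. *)
Definition splits (k : nat) (x : {ffun 'I_k -> T}) (f : {ffun 'I_k -> bool}) : bool :=
  [forall i, forall j, (f i == f j) ==> (e (x i) (x j) != Some (~~ f i))].

Definition split_tuple (k : nat) (x : {ffun 'I_k -> T}) : bool := [exists f, splits x f].

Definition nbr_count (c : bool) (u : T) : nat := #|[set v | e u v == Some c]|.

End SplitTuples.

Section Sampling.
Import all_order all_algebra ring lra.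
Import Order.TTheory GRing.Theory Num.Theory.
Local Open Scope ring_scope.
Variables (T : finType) (e : T -> T -> option bool) (m : nat).
Hypothesis e_sym : forall u v, e u v = e v u.
Hypothesis T_gt0 : (0 < #|T|)%N.
Implicit Types (x : {ffun 'I_m -> T}) (c : bool).

Let n : rat := #|T|%:R.
Let n_gt0 : 0 < n. Proof. by rewrite ltr0n. Qed.

Definition update x (j : 'I_m) (w : T) : {ffun 'I_m -> T} :=
  [ffun i => if i == j then w else x i].

(** Resampling coordinate [j] keeps the uniform distribution: exchanging [w] with the old coordinate
    is an involution of the pairs. *)
Lemma sum_update (j : 'I_m) (F : {ffun 'I_m -> T} -> rat) :
  \sum_x \sum_w F (update x j w) = n * \sum_x F x.
Proof.
pose h (xw : {ffun 'I_m -> T} * T) := (update xw.1 j xw.2, xw.1 j).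
have hK : involutive h.
  move=> [x w]; rewrite /h /update /= !ffunE eqxx; congr (_, _).
  by apply/ffunP=> i; rewrite !ffunE; case: eqP => [->|].
rewrite (pair_big xpredT xpredT (fun x w => F (update x j w))) /=.
rewrite (reindex_inj (inv_inj hK)) /=.
rewrite mulr_sumr (eq_bigr (fun xw => F xw.1)) => [|[x w] _]; last first.
  by have [-> _] : (h (h (x, w))) = (x, w) := hK _.
rewrite -(pair_big xpredT xpredT (fun x w => F x)) /=.
by apply: eq_bigr => x _; rewrite sumr_const mulr_natl.
Qed.

(** Expected minus actual, so that a shortage of colour [c] counts as positive. *)
Definition deviation c (u v : T) : rat :=
  (nbr_count e c u)%:R / n - (e u v == Some c)%:R.

Lemma sum_deviation c u : \sum_v deviation c u v = 0.
Proof.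
rewrite /deviation big_split /= sumr_const -[_ *+ _]mulr_natr divfK ?gt_eqF //.
rewrite sumrN -natr_sum; apply/eqP; rewrite subr_eq0; apply/eqP; congr _%:R.
by rewrite /nbr_count -sum1_card big_mkcond /=; apply: eq_bigr => v _; rewrite inE; case: eqP.
Qed.

Lemma deviation_sqr_le1 c u v : deviation c u v ^+ 2 <= 1.
Proof.
have p0 : 0 <= (nbr_count e c u)%:R / n by rewrite divr_ge0 ?ler0n.
have p1 : (nbr_count e c u)%:R / n <= 1.
  by rewrite ler_pdivrMr // mul1r ler_nat max_card.
rewrite /deviation; move: p0 p1; set p := _ / _ => p0 p1.
by case: (_ == _); rewrite /= ?mulr1n ?mulr0n; nra.
Qed.

Definition total_deviation c x (i : 'I_m) : rat :=
  \sum_(j | j != i) deviation c (x i) (x j).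

(** Coordinate [k] occurs only in the second factor, whose average over it is zero. *)
Lemma covariance0 c (i j k : 'I_m) : i != k -> j != k ->
  \sum_(x : {ffun 'I_m -> T}) deviation c (x i) (x j) * deviation c (x i) (x k) = 0.
Proof.
move=> ik jk; apply: (mulfI (x := n)); first by rewrite gt_eqF.
rewrite mulr0 -(sum_update k); apply: big1 => x _.
rewrite (eq_bigr (fun w => deviation c (x i) (x j) * deviation c (x i) w)) => [|w _].
  by rewrite -mulr_sumr sum_deviation mulr0.
by rewrite !ffunE (negbTE ik) (negbTE jk) eqxx.
Qed.

(** After expanding the square only the terms with [j = k] survive, at most [m] of them and each at
    most 1. *)
Lemma second_moment c (i : 'I_m) :
  \sum_(x : {ffun 'I_m -> T}) total_deviation c x i ^+ 2 <= m%:R * n ^+ m.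
Proof.
rewrite (eq_bigr (fun x : {ffun 'I_m -> T} => \sum_(j | j != i) \sum_(k | k != i)
    deviation c (x i) (x j) * deviation c (x i) (x k))); last first.
  by move=> x _; rewrite expr2 mulr_suml; apply: eq_bigr => j _; rewrite mulr_sumr.
rewrite exchange_big /=.
apply: (@le_trans _ _ (\sum_(j < m | j != i) n ^+ m)); last first.
  rewrite sumr_const -[X in X <= _]mulr_natl ler_wpM2r ?exprn_ge0 ?ler0n // ler_nat.
  by rewrite -[X in (_ <= X)%N]card_ord max_card.
apply: ler_sum => j ji; rewrite exchange_big /= (bigD1 j) //= [X in _ + X]big1 => [|k /andP[ki kj]].
  rewrite addr0; apply: (@le_trans _ _ (\sum_(x : {ffun 'I_m -> T}) 1)).
    by apply: ler_sum => x _; rewrite -expr2 deviation_sqr_le1.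
  by rewrite sumr_const card_ffun card_ord natrX.
by apply: covariance0; rewrite eq_sym.
Qed.

(** A counted pair has different labels, and at most one of its two orders is counted. So the sum is
    at most the product of the sizes of the label classes, computed here through signs. *)
Lemma split_cross_edges x (f : {ffun 'I_m -> bool}) : splits e x f ->
  \sum_i \sum_j (e (x i) (x j) == Some (~~ f i))%:R <= m%:R ^+ 2 / 4%:R :> rat.
Proof.
move=> /forallP fP; pose s i : rat := if f i then 1 else -1.
have s_prod i j : (1 - s i * s j) / 2%:R = (f i != f j)%:R.
  by rewrite /s; case: (f i); case: (f j); apply/eqP.
set D := \sum_i _.
have : D + D <= \sum_i \sum_j (1 - s i * s j) / 2%:R.
  rewrite {2}/D exchange_big -big_split /=; apply: ler_sum => i _.
  rewrite -big_split /=; apply: ler_sum => j _; rewrite s_prod (e_sym (x j)) -natrD ler_nat.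
  have /forallP/(_ j)/implyP := fP i; have /forallP/(_ i)/implyP := fP j; rewrite (e_sym (x j)).
  by case: (e (x i) (x j)) => [[]|]; case: (f i); case: (f j) => //= H1 H2;
    try (by have := H1 isT); try (by have := H2 isT).
have -> : \sum_i \sum_j (1 - s i * s j) / 2%:R = (m%:R ^+ 2 - (\sum_i s i) ^+ 2) / 2%:R.
  rewrite [(\sum_i s i) ^+ 2]expr2 mulr_suml.
  rewrite (eq_bigr (fun i => m%:R / 2%:R - (s i * \sum_j s j) / 2%:R)) => [|i _].
    rewrite big_split /= sumr_const card_ord sumrN -mulr_suml -mulr_natl; ring.
  rewrite -mulr_suml big_split /= sumr_const card_ord sumrN -mulr_sumr; ring.
have := sqr_ge0 (\sum_i s i); move: (_ ^+ 2) (m%:R ^+ 2) => a b; lra.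
Qed.

(** The degrees predict about [(1/4 + 1/q) * m ^ 2] pairs of the colour opposite to the first label,
    while a split sample has at most [m ^ 2 / 4]. This shortage forces a large sum of squares. *)
Lemma split_deviation (q : rat) x : 4%:R <= q -> q <= m%:R ->
  (forall c u, (4%:R^-1 + q^-1) * n <= (nbr_count e c u)%:R) ->
  split_tuple e x ->
  m%:R ^+ 3 / (4%:R * q ^+ 2) <= \sum_i \sum_c total_deviation c x i ^+ 2.
Proof.
move=> q4 qm bal /existsP[f fP].
have q0 : 0 < q by lra.
have m0 : 0 < m%:R :> rat by lra.
set Z := \sum_i _; pose M : rat := m%:R; rewrite -/M in qm m0 *.
have iq0 : 0 < q^-1 by rewrite invr_gt0.
have iq4 : q^-1 <= 4%:R^-1 by rewrite lef_pV2 ?posrE.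
(* The inequality [d <= M / (4 * q) + q / M * d ^ 2] is a completed square around [M / (2 * q)]; it
   serves in place of Cauchy-Schwarz. *)
have up : \sum_i total_deviation (~~ f i) x i <= M ^+ 2 / (4%:R * q) + q / M * Z.
  have -> : M ^+ 2 / (4%:R * q) = \sum_(i < m) M / (4%:R * q).
    by rewrite sumr_const card_ord -[RHS]mulr_natl -/M; field; rewrite gt_eqF.
  rewrite mulr_sumr -big_split /=; apply: ler_sum => i _.
  set d := total_deviation _ _ _.
  have le : d ^+ 2 <= \sum_c total_deviation c x i ^+ 2.
    by rewrite (bigD1 (~~ f i)) //= lerDl sumr_ge0 // => c _; rewrite sqr_ge0.
  apply: (@le_trans _ _ (M / (4%:R * q) + q / M * d ^+ 2)); last first.
    by rewrite lerD2l ler_wpM2l // divr_ge0 // ltW.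
  rewrite -subr_ge0.
  have -> : M / (4%:R * q) + q / M * d ^+ 2 - d = q / M * (d - M / (2%:R * q)) ^+ 2.
    by field; rewrite !gt_eqF.
  by rewrite mulr_ge0 ?sqr_ge0 // divr_ge0 // ltW.
have low : M * (M - 1) * (4%:R^-1 + q^-1) - M ^+ 2 / 4%:R <=
    \sum_i total_deviation (~~ f i) x i.
  have cross := split_cross_edges fP.
  have -> : M * (M - 1) * (4%:R^-1 + q^-1) = \sum_(i < m) (M - 1) * (4%:R^-1 + q^-1).
    by rewrite sumr_const card_ord -[RHS]mulr_natl mulrA.
  apply: (le_trans (lerB (lexx _) cross)); rewrite -sumrB; apply: ler_sum => i _.
  rewrite /total_deviation /deviation sumrB; apply: lerB.
    rewrite sumr_const; have -> : #|(fun j : 'I_m => j != i)| = m.-1.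
      by have := cardC1 i; rewrite card_ord => <-; apply: eq_card.
    rewrite -[leRHS]mulr_natl; have -> : m.-1%:R = M - 1.
      by rewrite -subn1 natrB // -(ltr_nat rat).
    by rewrite ler_wpM2l ?subr_ge0 ?ler_pdivlMr //; lra.
  by rewrite [leRHS](bigD1 i) //= lerDr ler0n.
have key : M ^+ 2 / (4%:R * q) <= q / M * Z.
  have e1 : M ^+ 2 / (4%:R * q) = M * M * q^-1 / 4%:R by field; rewrite gt_eqF.
  have qi : 1 <= M * q^-1 by rewrite ler_pdivlMr ?mul1r.
  have h : 0 <= M * (M * q^-1 - 1) by rewrite mulr_ge0 ?subr_ge0 // ltW.
  have h2 : M * q^-1 <= M / 4%:R by rewrite ler_wpM2l // ltW.
  have le := le_trans low up.
  rewrite e1 in le *; rewrite expr2 in le; lra.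
have -> : M ^+ 3 / (4%:R * q ^+ 2) = M ^+ 2 / (4%:R * q) * (M / q).
  by field; rewrite gt_eqF.
rewrite -ler_pdivlMr ?divr_gt0 //; apply: le_trans key _.
by rewrite le_eqVlt; apply/orP; left; apply/eqP; field; rewrite !gt_eqF.
Qed.

(** Markov's inequality: the squared deviations sum to at most [2 * m ^ 2 * n ^ m] over colours,
    positions and samples, and each split sample takes at least [m ^ 3 / (4 * q ^ 2)] of this. *)
Lemma nonsplit_half (q : nat) : (4 <= q)%N -> (16 * q ^ 2 <= m)%N ->
  (forall c u, ((q + 4) * #|T| <= 4 * q * nbr_count e c u)%N) ->
  (#|T| ^ m <= 2 * #|[set x : {ffun 'I_m -> T} | ~~ split_tuple e x]|)%N.
Proof.
move=> q4 qm bal.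
have q0 : 0 < q%:R :> rat by rewrite ltr0n; lia.
have m0 : 0 < m%:R :> rat by rewrite ltr0n; lia.
have q4R : 4%:R <= q%:R :> rat by rewrite ler_nat.
have qmR : 16%:R * q%:R ^+ 2 <= m%:R :> rat by rewrite -natrX -natrM ler_nat.
have qm' : q%:R <= m%:R :> rat by rewrite ler_nat; nia.
have balR c u : (4%:R^-1 + q%:R^-1) * n <= (nbr_count e c u)%:R.
  have : ((q + 4) * #|T|)%:R <= (4 * q * nbr_count e c u)%:R :> rat by rewrite ler_nat.
  rewrite !natrM natrD -/n => le; rewrite -(ler_pM2l (x := 4%:R * q%:R)) ?mulr_gt0 //.
  by apply: le_trans le; rewrite le_eqVlt; apply/orP; left; apply/eqP; field; rewrite gt_eqF.
set S := [set x : {ffun 'I_m -> T} | split_tuple e x].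
have moment : #|S|%:R * (m%:R ^+ 3 / (4%:R * q%:R ^+ 2)) <= 2%:R * m%:R ^+ 2 * n ^+ m.
  apply: (@le_trans _ _ (\sum_(x : {ffun 'I_m -> T}) \sum_i \sum_c total_deviation c x i ^+ 2)).
    rewrite mulr_natl -sumr_const [leRHS](bigID (mem S)) /= ler_wpDr //.
      by do 3![apply: sumr_ge0 => ? _]; rewrite sqr_ge0.
    by apply: ler_sum => x; rewrite inE; apply: split_deviation.
  rewrite exchange_big /=; apply: (@le_trans _ _ (\sum_(i < m) 2%:R * (m%:R * n ^+ m))).
    apply: ler_sum => i _; rewrite exchange_big /= big_bool /=.
    by rewrite mulr_natl mulr2n; apply: lerD; apply: second_moment.
  by rewrite sumr_const card_ord -[leLHS]mulr_natl le_eqVlt; apply/orP; left; apply/eqP; ring.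
have : #|S|%:R * 2%:R <= n ^+ m.
  have c0 : 0 < m%:R ^+ 2 * 2%:R :> rat by rewrite mulr_gt0 ?exprn_gt0.
  rewrite -(ler_pM2l c0) [leRHS](_ : _ = 2%:R * m%:R ^+ 2 * n ^+ m); last by ring.
  apply: le_trans moment.
  have -> : m%:R ^+ 2 * 2%:R * (#|S|%:R * 2%:R) = #|S|%:R * (m%:R ^+ 2 * 4%:R) :> rat by ring.
  rewrite ler_wpM2l ?ler0n // ler_pdivlMr ?mulr_gt0 ?exprn_gt0 //.
  have -> : m%:R ^+ 2 * 4%:R * (4%:R * q%:R ^+ 2) = m%:R ^+ 2 * (16%:R * q%:R ^+ 2) :> rat by ring.
  by rewrite (exprSr _ 2) ler_wpM2l // exprn_ge0 // ltW.
rewrite /n -natrX -natrM ler_nat => leS.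
have : #|[set x : {ffun 'I_m -> T} | ~~ split_tuple e x]| = #|~: S|.
  by apply: eq_card => x; rewrite !inE.
by have := cardsC S; rewrite card_ffun card_ord; lia.
Qed.

End Sampling.

(** * From samples to cliques *)

Section Subtuples.
Variables (T : finType).

(** A tuple is determined by its restriction along [iota] and its values at the other [m - k]
    positions. *)
Lemma card_restrict_le (k m : nat) (iota : 'I_k -> 'I_m) (P : pred {ffun 'I_k -> T}) :
  injective iota ->
  #|[set x : {ffun 'I_m -> T} | P [ffun i => x (iota i)]]| <= #|T| ^ (m - k) * #|[set y | P y]|.
Proof.
move=> iota_inj; set A := [set x | _].
pose rest := {i : 'I_m | i \notin codom iota}.
pose h (x : {ffun 'I_m -> T}) : {ffun 'I_k -> T} * {ffun rest -> T} :=
  ([ffun i => x (iota i)], [ffun c => x (val c)]).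
have h_inj : injective h.
  move=> x1 x2 [/ffunP eq1 /ffunP eq2]; apply/ffunP => i.
  have [/codomP[j ->]|iN] := boolP (i \in codom iota).
    by have := eq1 j; rewrite !ffunE.
  by have := eq2 (exist _ i iN); rewrite !ffunE.
have -> : m - k = #|{: rest}|.
  rewrite card_sig -[m in LHS]card_ord -(cardC (mem (codom iota))).
  rewrite (card_codom iota_inj) card_ord addKn; apply: eq_card => i.
  by rewrite !inE.
rewrite -card_ffun mulnC -cardsT -cardsX -(card_imset _ h_inj).
apply: subset_leq_card; apply/subsetP=> _ /imsetP[x xA ->].
by rewrite !inE /= andbT; rewrite inE in xA.
Qed.

Lemma card_tuple_transversal (S : pred (seq T)) (k : nat) :
  #|[set s : k.-tuple T | S s]| = transversal_sum S (nseq k [set: T]).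
Proof.
rewrite -sum1_card (eq_bigl (fun s : k.-tuple T => S s)) => [|s]; last by rewrite inE.
rewrite big_mkcond /=; transitivity (\sum_(s : k.-tuple T) (S s : nat)).
  by apply: eq_bigr => s _; case: (S s).
elim: k S => [|k IH] S /=.
  by rewrite (big_pred1 [tuple]) // => s; apply/esym/eqP/val_inj; case: s => -[].
pose h (vs : T * k.-tuple T) := [tuple of vs.1 :: vs.2].
pose h' (s : k.+1.-tuple T) := (thead s, [tuple of behead s]).
have hK : cancel h h' by move=> [v s]; congr (_, _); apply: val_inj.
have h'K : cancel h' h by move=> s; rewrite /h /h' /= [RHS]tuple_eta.
rewrite (reindex h); last by apply: onW_bij; exists h'.
rewrite -(pair_big xpredT xpredT (fun v (s : k.-tuple T) => S (v :: s) : nat)) /=.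
rewrite [RHS](eq_bigl xpredT) => [|v]; last by rewrite inE.
by apply: eq_bigr => v _; rewrite (IH (fun s => S (v :: s))).
Qed.

End Subtuples.

(** * Non-split 5-tuples inside non-split samples *)

Section Colouring.
Variables (T : finType) (col : T -> T -> bool).
Hypothesis colC : forall u v, col u v = col v u.

Definition edge_colour (u v : T) : option bool := if u == v then None else Some (col u v).

Lemma edge_colourC u v : edge_colour u v = edge_colour v u.
Proof. by rewrite /edge_colour eq_sym colC. Qed.

Lemma nonsplit_subtuple (m : nat) (x : {ffun 'I_m -> T}) : 5 <= m ->
  ~~ split_tuple edge_colour x ->
  exists2 iota : {ffun 'I_5 -> 'I_m}, injective iota &
    ~~ split_tuple edge_colour [ffun i => x (iota i)].
Proof.
move=> m5 nsx; pose g u v := (u != v) && col u v.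
have g_sym : symmetric g by move=> u v; rewrite /g eq_sym colC.
have g_irr : irreflexive g by move=> u; rewrite /g eqxx.
have [[f Hf]|[s [s_uniq s5 sX Hs]]] := foldes_hammer g_sym g_irr [set x i | i : 'I_m].
  case/existsP: nsx; exists [ffun i => f (x i)].
  apply/forallP=> i; apply/forallP=> j; rewrite !ffunE /edge_colour; apply/implyP => /eqP fij.
  case: (x i =P x j) => // /eqP nij.
  have := Hf (x i) (x j) (imset_f _ isT) (imset_f _ isT) nij fij.
  by rewrite /g nij /= => ->; apply/eqP => -[]; case: (f _).
pose i0 : 'I_m := Ordinal (leq_trans (ltn0Sn 4) m5).
pose idx v := odflt i0 [pick i | x i == v].
have xidx v : v \in s -> x (idx v) = v.
  move/sX/imsetP=> [i _ ->]; rewrite /idx; case: pickP => [j /eqP //|/(_ i)].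
  by rewrite eqxx.
pose js := map idx s.
have js_uniq : uniq js.
  by rewrite map_inj_in_uniq // => u v us vs eq_idx; rewrite -(xidx u us) eq_idx xidx.
(* The indices of the obstruction come first, so the first five entries of [L] contain them all and
   are distinct. *)
pose L := js ++ [seq j <- enum 'I_m | j \notin js].
have L_uniq : uniq L.
  rewrite cat_uniq js_uniq filter_uniq ?enum_uniq // andbT -all_predC.
  by apply/allP=> j; rewrite mem_filter => /andP[].
have L_size : size L = m.
  rewrite -[RHS]card_ord -(card_uniqP L_uniq); apply: eq_card => j.
  by rewrite mem_cat mem_filter mem_enum andbT orbN.
pose iota := [ffun i : 'I_5 => nth i0 L i].
exists iota.
  move=> i j /eqP; rewrite !ffunE nth_uniq ?L_size ?(leq_trans (ltn_ord _)) //.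
  by move/eqP/val_inj.
apply/existsP=> -[F /forallP FP].
pose k v : 'I_5 := inord (index v s).
have /hasP[u us /hasP[v vs /and3P[nuv /eqP fuv /eqP guv]]] := Hs (fun v => F (k v)).
have yk w : w \in s -> x (iota (k w)) = w.
  move=> ws; have ltw : index w s < size s by rewrite index_mem.
  rewrite ffunE inordK ?(leq_trans ltw) // nth_cat size_map ltw.
  by rewrite (nth_map w) // nth_index // xidx.
have /forallP/(_ (k v))/implyP := FP (k u).
rewrite !(ffunE (fun i => x (iota i))) (yk u us) (yk v vs) fuv eqxx => /(_ isT).
by move: guv; rewrite /g /edge_colour nuv (negbTE nuv) /= => ->; rewrite fuv eqxx.
Qed.

(** Union bound over at most [m ^ 5] injections, each accounting for at most [#|T| ^ (m - 5)]
    samples per non-split 5-tuple. *)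
Lemma nonsplit_5tuples (m : nat) : 5 <= m -> 0 < #|T| ->
  #|T| ^ m <= 2 * #|[set x : {ffun 'I_m -> T} | ~~ split_tuple edge_colour x]| ->
  #|T| ^ 5 <= 2 * m ^ 5 * #|[set y : {ffun 'I_5 -> T} | ~~ split_tuple edge_colour y]|.
Proof.
move=> m5 T0; set A := [set x | _]; set B := [set y | _] => leA.
pose C (iota : {ffun 'I_5 -> 'I_m}) :=
  [set x : {ffun 'I_m -> T} | ~~ split_tuple edge_colour [ffun i => x (iota i)]].
have sAC : #|A| <= \sum_(iota : {ffun 'I_5 -> 'I_m} | injectiveb iota) #|C iota|.
  apply: (@leq_trans
    (\sum_(x in A) \sum_(iota : {ffun 'I_5 -> 'I_m} | injectiveb iota) (x \in C iota))).
    rewrite -sum1_card; apply: leq_sum => x; rewrite inE.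
    case/(nonsplit_subtuple m5) => iota /injectiveP inj ns.
    by rewrite (bigD1 iota) //= inE ns.
  rewrite exchange_big /=; apply: leq_sum => iota _.
  rewrite -sum1_card [X in _ <= X]big_mkcond /= big_mkcond /=.
  by apply: leq_sum => x _; do 2![case: ifP => //]; case: (x \in C iota).
have : #|A| <= m ^ 5 * (#|T| ^ (m - 5) * #|B|).
  apply: leq_trans sAC _.
  apply: (@leq_trans (\sum_(iota : {ffun 'I_5 -> 'I_m} | injectiveb iota) #|T| ^ (m - 5) * #|B|)).
    by apply: leq_sum => iota /injectiveP inj; apply: card_restrict_le.
  rewrite sum_nat_const leq_mul2r; apply/orP; right.
  by apply: leq_trans (max_card _) _; rewrite card_ffun !card_ord.
move=> le; have Tm0 : 0 < #|T| ^ (m - 5) by rewrite expn_gt0 T0.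
rewrite -(leq_pmul2l Tm0) -expnD subnK //.
apply: leq_trans leA _; move: le; move: (m ^ 5) (#|T| ^ (m - 5)) #|A| #|B| => a b c d; lia.
Qed.

Lemma blowup_pattern_edges (s : seq T) (As : seq {set T}) :
  blowup edge_colour (pattern edge_colour s) As ->
  forall v0 i j a b, i < j < size s -> a \in nth set0 As i -> b \in nth set0 As j ->
  edge_colour a b = edge_colour (nth v0 s i) (nth v0 s j).
Proof.
have joinedP v a s' Bs : joined edge_colour a [seq edge_colour v u | u <- s'] Bs ->
    forall v0 j b, j < size s' -> b \in nth set0 Bs j ->
    edge_colour a b = edge_colour v (nth v0 s' j).
  elim: s' Bs => [|u s' IH] [|B Bs] //= [aB aBs] v0 [|j] b /= ltj bB; first exact: aB.
  exact: IH aBs _ _ _ ltj bB.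
elim: s As => [|v s IH] As; first by move=> _ v0 i j a b /andP[].
case: As => [|A As] //= [Ajoin blAs] v0 [|i] [|j] a b //= => [ltj aA bB|ltij aA bB].
  exact: joinedP (Ajoin a aA) _ _ _ ltj bB.
exact: IH blAs _ _ _ _ _ ltij aA bB.
Qed.

End Colouring.

(** Unfolding gives [k] factors [4 * (2 ^ i * q)] with [i < k], each at most [2 ^ (k + 2) * q]. *)
Lemma dens_le k q : 0 < q -> dens k q <= (2 ^ (k + 2) * q) ^ k.
Proof.
elim: k q => // k IH q q0; rewrite [dens _ _]/= expnS.
have q20 : 0 < 2 * q by rewrite muln_gt0.
apply: leq_mul.
  by rewrite leq_mul2r -[4]/(2 ^ 2) leq_exp2l ?leq_addl ?orbT.
by apply: leq_trans (IH _ q20) _; rewrite mulnA -expnSr.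
Qed.

Lemma loss_le k q : 0 < q -> loss k q <= (2 ^ (k + 2) * q) ^ (k * k).
Proof.
elim: k q => // k IH q q0; have q20 : 0 < 2 * q by rewrite muln_gt0.
change (dens k.+1 q * loss k (2 * q) <= (2 ^ (k.+1 + 2) * q) ^ (k.+1 * k.+1)).
apply: leq_trans (leq_mul (dens_le _ q0) (IH _ q20)) _.
rewrite mulnA -expnSr -addSn -expnD leq_pexp2l ?muln_gt0 ?expn_gt0 //.
by lia.
Qed.

(** * From a blown-up pattern to the two cliques *)

Section SplitPair.
Variables (T : finType) (col : T -> T -> bool).
Hypothesis colC : forall u v, col u v = col v u.
Let e := edge_colour col.

Lemma nonsplit_blowup_pair (k : nat) (y : {ffun 'I_k -> T}) (As : seq {set T}) (t : nat) :
  ~~ split_tuple e y -> blowup e (pattern e (mktuple y)) As ->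
  (forall A, A \in As -> t <= #|A| /\ exists c, monochromatic col c A) ->
  exists (A B : {set T}) (c : bool), [/\ [disjoint A & B], #|A| = t /\ #|B| = t,
    monochromatic col c A, monochromatic col c B &
    forall a b, a \in A -> b \in B -> col a b = ~~ c].
Proof.
move=> nsy bl HA; have szA : size As = k.
  by rewrite (size_blowup bl) size_pattern size_tuple.
have memA (i : 'I_k) : nth set0 As i \in As by rewrite mem_nth ?szA.
pose f := [ffun i : 'I_k => [forall a in nth set0 As i, forall b in nth set0 As i,
  (a != b) ==> col a b]].
have f_mono i : monochromatic col (f i) (nth set0 As i).
  rewrite ffunE; case: forall_inP => [H a b aA bA nab|H].
    by have /forall_inP/(_ b bA)/implyP := H a aA; apply.
  have [_ [[] mc //]] := HA _ (memA i).
  case: H => a aA; apply/forall_inP => b bA; apply/implyP => nab; exact: mc.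
have [i [j [ltij fij eij]]] : exists i j : 'I_k,
    [/\ i < j, f i = f j & e (y i) (y j) = Some (~~ f i)].
  have [i [j [nij fij eij]]] : exists i j : 'I_k,
      [/\ i != j, f i = f j & e (y i) (y j) = Some (~~ f i)].
    move: nsy; rewrite negb_exists => /forallP/(_ f); rewrite negb_forall => /existsP[i].
    rewrite negb_forall => /existsP[j]; rewrite negb_imply negbK => /andP[/eqP fij /eqP eij].
    exists i, j; split=> //; apply: contra_eqN eij => /eqP ->.
    by rewrite /e /edge_colour eqxx.
  (* A pattern records colours only from earlier to later positions, so the pair is put in
     increasing order. *)
  move: nij; rewrite -val_eqE neq_ltn => /orP[ltij|ltji]; first by exists i, j.
  by exists j, i; split=> //; rewrite /e edge_colourC // -fij.
have trim (i' : 'I_k) : exists2 A : {set T}, A \subset nth set0 As i' & #|A| = t.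
  have [tA _] := HA _ (memA i').
  exists [set a in take t (enum (nth set0 As i'))].
    by apply/subsetP=> a; rewrite inE => /mem_take; rewrite mem_enum.
  rewrite cardsE (card_uniqP _) ?take_uniq ?enum_uniq // size_takel // -cardE; exact: tA.
have [A sA cA] := trim i; have [B sB cB] := trim j.
have cross a b : a \in A -> b \in B -> e a b = Some (~~ f i).
  move=> /(subsetP sA) aA /(subsetP sB) bB.
  have ltijk : i < j < size (mktuple y) by rewrite size_tuple ltij /=.
  rewrite /e (blowup_pattern_edges bl (y i) ltijk aA bB).
  by rewrite !nth_mktuple.
exists A, B, (f i); split=> //.
(* A vertex in both sets would have the colour [None] with itself. *)
- apply/pred0P => a /=; apply/negbTE/andP => -[aA aB].
  by have := cross a a aA aB; rewrite /e /edge_colour eqxx.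
- exact: monochromatic_sub (f_mono i).
- by rewrite fij; apply: monochromatic_sub (f_mono j).
by move=> a b aA bB; have := cross a b aA bB; rewrite /e /edge_colour; case: eqP => // _ [].
Qed.

(** There are [3 ^ 25] colour matrices, three values for each ordered pair of positions, so fixing a
    frequent one costs this factor in density. Starting from size [loss 5 q' * t] leaves at least
    [t] vertices in each part. *)
Lemma dense_nonsplit_pair (q t : nat) : 0 < q -> 0 < t -> 0 < #|T| ->
  #|T| ^ 5 <= q * #|[set y : {ffun 'I_5 -> T} | ~~ split_tuple e y]| ->
  let q' := 3 ^ 25 * q in dens 5 q' * 2 ^ (6 * (loss 5 q' * t)) <= #|T| ->
  exists (A B : {set T}) (c : bool), [/\ [disjoint A & B], #|A| = t /\ #|B| = t,
    monochromatic col c A, monochromatic col c B &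
    forall a b, a \in A -> b \in B -> col a b = ~~ c].
Proof.
move=> q0 t0 T0; set N := [set y | _] => leN q' leT.
have q'0 : 0 < q' by rewrite muln_gt0 expn_gt0.
pose H (y : {ffun 'I_5 -> T}) := [ffun ij : 'I_5 * 'I_5 => e (y ij.1) (y ij.2)].
have [|h _] := @pigeonhole _ _ [set: {ffun 'I_5 * 'I_5 -> option bool}] H N
  [ffun=> None] (in_setT _).
  by move=> y _; rewrite inE.
rewrite cardsT card_ffun card_prod card_ord card_option card_bool => leNh.
set F := [set y in N | H y == h] in leNh.
have leF : #|T| ^ 5 <= q' * #|F|.
  by apply: leq_trans leN _; rewrite /q' -mulnA mulnCA leq_mul2l leNh orbT.
have [y0 y0F] : exists y, y \in F.
  apply/set0Pn; rewrite -card_gt0; move: leF; case: #|F| => //.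
  by rewrite muln0 leqn0 expn_eq0 eqn0Ngt T0.
pose p := pattern e (mktuple y0).
have szp : size p = 5 by rewrite size_pattern size_tuple.
have [v0 _] : exists v0, v0 \in [set: T] by apply/set0Pn; rewrite -card_gt0 cardsT.
pose of_seq (s : seq T) := [ffun i : 'I_5 => nth v0 s i].
pose S : pred (seq T) := fun s => of_seq s \in F.
have Sp s : size s = size p -> S s -> pattern e s = p.
  rewrite szp => szs; rewrite /S inE => /andP[_ /eqP Hs].
  move: y0F; rewrite inE => /andP[_ /eqP Hy0].
  apply: (pattern_ext (v0 := v0)); first by rewrite szs size_tuple.
  rewrite szs => i j lti ltj.
  have /ffunP/(_ (Ordinal lti, Ordinal ltj)) : H (of_seq s) = H y0 by rewrite Hs.
  by rewrite !ffunE -[i]/(val (Ordinal lti)) -[j]/(val (Ordinal ltj)) !nth_mktuple.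
have leS : #|T| ^ size p <= q' * transversal_sum S (nseq (size p) setT).
  rewrite szp; apply: leq_trans leF _; rewrite leq_mul2l; apply/orP; right.
  rewrite -card_tuple_transversal.
  have inj : injective (fun y : {ffun 'I_5 -> T} => mktuple y).
    by move=> y1 y2 eq12; apply/ffunP => i; rewrite -(tnth_mktuple y1) eq12 tnth_mktuple.
  rewrite -(card_imset _ inj); apply: subset_leq_card.
  apply/subsetP=> _ /imsetP[y yF ->]; rewrite inE /S.
  by have -> : of_seq (mktuple y) = y by apply/ffunP => i; rewrite ffunE nth_mktuple.
have M0 : 0 < loss 5 q' * t by rewrite muln_gt0 loss_gt0.
have leT' : dens (size p) q' * 2 ^ ((size p).+1 * (loss 5 q' * t)) <= #|T| by rewrite szp.
have [As [bl cardA monoA _]] := blowup_exists colC M0 q'0 Sp leS leT'.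
apply: (nonsplit_blowup_pair _ bl) => [|A AAs].
  by move: y0F; rewrite !inE => /andP[].
split; last exact: monoA.
have [_] := cardA A AAs; rewrite szp leq_pmul2l //.
exact: loss_gt0.
Qed.

End SplitPair.

(** With [Q = 2 ^ 7 * q'], the bound [Q <= q ^ 53] adds the exponents 7 + 25 + 1 + 20. The total
    exponent of 2 is at most [7 * Q ^ 25 * t], and [7 <= q ^ 2] leads to 1327 = 2 + 53 * 25. *)
Lemma threshold_bound (q q' t : nat) :
  4 <= q -> 0 < t -> q' = 3 ^ 25 * (2 * (16 * q ^ 2) ^ 5) ->
  dens 5 q' * 2 ^ (6 * (loss 5 q' * t)) <= 2 ^ (t * q ^ 1327).
Proof.
move=> q4 t0 q'E.
have q0 : 0 < q by apply: leq_trans q4.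
have q'0 : 0 < q' by rewrite q'E !(muln_gt0, expn_gt0) q0.
pose Q := 2 ^ (5 + 2) * q'.
have Q0 : 0 < Q by rewrite /Q !(muln_gt0, expn_gt0).
have q16 : 16 <= q ^ 2 by rewrite -[16]/(4 ^ 2) leq_exp2r.
have Qle : Q <= q ^ 53.
  have -> : q ^ 53 = q ^ (5 + 2) * (q ^ 25 * (q * (q ^ 2 * q ^ 2) ^ 5)).
    by rewrite -expnD -expnM -expnS -!expnD.
  rewrite /Q q'E; apply: leq_mul; first by rewrite leq_exp2r // (leq_trans _ q4).
  apply: leq_mul; first by rewrite leq_exp2r // (leq_trans _ q4).
  apply: leq_mul; first exact: leq_trans q4.
  by rewrite leq_exp2r // leq_mul2r q16 orbT.
apply: (@leq_trans (2 ^ (Q ^ 25 * t) * 2 ^ (6 * (Q ^ 25 * t)))).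
  apply: leq_mul.
    apply: leq_trans (dens_le 5 q'0) _; rewrite -/Q.
    apply: leq_trans (ltnW (ltn_expl _ (ltnSn 1))) _; rewrite leq_exp2l //.
    by rewrite -[X in X <= _]muln1 leq_mul // leq_pexp2l.
  by rewrite leq_exp2l // leq_mul2l leq_mul2r (loss_le 5 q'0) orbT.
rewrite -expnD leq_exp2l // -mulSn mulnA mulnC leq_mul2l; apply/orP; right.
have -> : q ^ 1327 = q ^ 2 * (q ^ 53) ^ 25 by rewrite -expnM -expnD.
rewrite leq_mul //.
  exact: leq_trans q16.
by rewrite leq_exp2r.
Qed.

Lemma split_pair_of_balanced (n q t : nat) (col : 'I_n -> 'I_n -> bool) :
  symmetric_colouring col -> 4 <= q -> 0 < t -> 2 ^ (t * q ^ 1327) <= n ->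
  (forall c u, (q + 4) * n <= 4 * q * coldeg col c u) ->
  has_split_pair col t.
Proof.
move=> colC q4 t0 len bal.
have n0 : 0 < #|'I_n| by rewrite card_ord (leq_trans _ len) ?expn_gt0.
have m5 : 5 <= 16 * q ^ 2.
  by apply: (@leq_trans (16 * 1)); rewrite // leq_mul2l expn_gt0 (leq_trans _ q4).
have q0 : 0 < 2 * (16 * q ^ 2) ^ 5 by rewrite !(muln_gt0, expn_gt0) (leq_trans _ q4).
have balT c u : (q + 4) * #|'I_n| <= 4 * q * nbr_count (edge_colour col) c u.
  rewrite card_ord; apply: leq_trans (bal c u) _; rewrite leq_mul2l; apply/orP; right.
  apply: subset_leq_card; apply/subsetP=> v; rewrite !inE /edge_colour eq_sym.
  by case: eqP => //= _ /eqP ->.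
have half := nonsplit_half (edge_colourC colC) n0 q4 (leqnn _) balT.
have dense := nonsplit_5tuples colC m5 n0 half.
have [|A [B [c [dAB [cA cB] mA mB cross]]]] := dense_nonsplit_pair colC q0 t0 n0 dense.
  by rewrite card_ord; apply: leq_trans (threshold_bound q4 t0 erefl) len.
by exists A, B, c; split.
Qed.

(* Passage to real parameters *)
From Stdlib Require Import ZArith Reals Lra.
(* Restores the notation of [expn], which Reals overrides in nat_scope. *)
Import ssrnat.

Lemma INR_expn a b : INR (a ^ b) = (INR a ^ b)%R.
Proof.
elim: b => [|b IH]; first by rewrite expn0.
by rewrite expnS mult_INR IH.
Qed.

(** For [y] the inverse of [eps], the integer [q = up y] is at most [y ^ 2], so
    [q ^ K <= exp (2 * K * ln y)]. Since [ln y >= 1], its eighth power may replace it, and the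
    factor [ln 2] in [C] turns the result into a power of 2. *)
Lemma log_threshold (K : nat) : (0 < K)%N -> exists C : R, (0 < C)%R /\
  forall (eps : R) (t n : nat), (0 < eps < 1/4)%R ->
    (Rpower 2 (INR t * Rpower 2 (C * (ln (/ eps)) ^ 8)) <= INR n)%R ->
    exists q, [/\ 4 <= q, (/ eps <= INR q)%R & 2 ^ (t * q ^ K) <= n].
Proof.
move=> K0; have ln2 : (0 < ln 2)%R by have := ln_lt_2; lra.
have K0R : (0 < INR K)%R by apply: lt_0_INR; apply/ltP.
exists (2 * INR K / ln 2)%R; split; first by apply: Rdiv_lt_0_compat; lra.
move=> eps t n [e0 e4] len.
have ie4 : (4 < / eps)%R.
  by rewrite -(Rinv_inv 4); apply: Rinv_lt_contravar; lra.
set y := (/ eps)%R in ie4 len *.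
have L1 : (1 <= ln y)%R.
  rewrite -(ln_exp 1); apply: Rlt_le; apply: ln_increasing; first exact: exp_pos.
  by have := exp_le_3; lra.
have [up1 up2] := archimed y.
have up0 : (0 <= up y)%Z by apply: le_IZR; lra.
exists (Z.to_nat (up y)); set q := Z.to_nat _.
have qR : INR q = IZR (up y) by rewrite INR_IZR_INZ /q Z2Nat.id.
have q4 : (4 <= q)%N.
  by apply/leP; apply: INR_le; rewrite qR /=; lra.
split=> //; first by lra.
apply/leP; apply: INR_le; apply: Rle_trans len.
rewrite INR_expn -Rpower_pow; last by rewrite /=; lra.
have -> : INR 2 = 2%R by [].
apply: Rle_Rpower; first lra.
rewrite mult_INR; apply: Rmult_le_compat_l; first exact: pos_INR.
have -> : Rpower 2 (2 * INR K / ln 2 * ln y ^ 8) = exp (2 * INR K * ln y ^ 8).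
  by rewrite /Rpower; congr exp; field; lra.
rewrite INR_expn; apply: (@Rle_trans _ ((y ^ 2) ^ K)).
  apply: pow_incr; split; first exact: pos_INR.
  by rewrite qR; nra.
have -> : ((y ^ 2) ^ K = exp (2 * INR K * ln y))%R.
  rewrite -pow_mult -Rpower_pow; last lra.
  by rewrite /Rpower mult_INR.
have exp_le a b : (a <= b -> exp a <= exp b)%R.
  by case=> [/exp_increasing/Rlt_le//|->]; apply: Rle_refl.
apply: exp_le; apply: Rmult_le_compat_l; first lra.
by rewrite -[X in (X <= _)%R]pow_1; apply: Rle_pow => //; lia.
Qed.

Theorem theorem1p3 :
  exists C : R, (0 < C)%R /\
  forall (eps : R) (t n : nat),
    (0 < eps < 1/4)%R -> (1 <= t)%N ->
    (Rpower 2 (INR t * Rpower 2 (C * (ln (/ eps)) ^ 8)) <= INR n)%R ->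
    forall col : 'I_n -> 'I_n -> bool,
      symmetric_colouring col ->
      locally_balanced col (1/4 + eps)%R ->
      has_split_pair col t.
Proof.
have K0 : (0 < 1327)%N by [].
have [C [C0 HC]] := log_threshold K0; exists C; split=> // eps t n eps14 t1 len col colC bal.
have [q [q4 qeps leqn]] := HC eps t n eps14 len.
apply: (split_pair_of_balanced colC q4 t1 leqn) => c u.
have deg : ((1/4 + eps) * INR n <= INR (coldeg col c u))%R.
  by case: c; case: (bal u).
have eq1 : (1 <= eps * INR q)%R.
  have e0 : (0 < eps)%R by case: eps14.
  by rewrite -(Rinv_r eps); [apply: Rmult_le_compat_l | ]; lra.
apply/leP; apply: INR_le; rewrite !mult_INR plus_INR.
have n0 := pos_INR n; have q0 := pos_INR q.
have -> : INR 4 = 4%R by rewrite /=; lra.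
(* The degree bound times [q], with [eps * q >= 1], gives [(q / 4 + 1) * n] as a lower bound for [q]
   times the degree: a quarter of the goal. *)
have : (0 <= INR q * (INR (coldeg col c u) - (1/4 + eps) * INR n))%R by apply: Rmult_le_pos; lra.
have : (0 <= (eps * INR q - 1) * INR n)%R by apply: Rmult_le_pos; lra.
lra.
Qed.
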